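(* If $L$ is a Lie algebra over $\mathbb Z$, then $2\delta_4(L)\subseteq\gamma_4(L)$.
   Context: $L$ is a Lie ring, i.e. a Lie algebra over $\mathbb Z$. Its lower central series is $\gamma_1(L)=L$ and, for $n\ge 1$, $\gamma_{n+1}(L)$ is the additive subgroup generated by all $[x,y]$ with $x\in L$, $y\in\gamma_n(L)$. $\mathscr U(L)$ is the universal enveloping algebra of $L$ over $\mathbb Z$, $\iota:L\to\mathscr U(L)$ is the natural map (injective over $\mathbb Z$), and $\varpi(L)$ is the augmentation ideal of $\mathscr U(L)$, i.e. the two-sided ideal generated by $\iota(L)$; $\varpi^n(L)$ is its $n$th power. The $n$th Lie dimension subring is $\delta_n(L)=L\cap\varpi^n(L)=\{x\in L:\iota(x)\in\varpi^n(L)\}$, $n\ge1$. *)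

(* Defs.v *)
From HB Require Import structures.
From mathcomp Require Import all_boot all_algebra generic_quotient.
From mathcomp Require Import boolp classical_sets.

Set Implicit Arguments.
Unset Strict Implicit.
Unset Printing Implicit Defensive.

Import GRing.Theory.
Local Open Scope classical_set_scope.
Local Open Scope ring_scope.

HB.mixin Record isLieRing L of GRing.Zmodule L := {
  bracket : L -> L -> L;
  bracketDl : forall x y z, bracket (x + y) z = bracket x z + bracket y z;
  bracketDr : forall x y z, bracket x (y + z) = bracket x y + bracket x z;
  bracketxx : forall x, bracket x x = 0;
  bracket_jacobi : forall x y z,
    bracket x (bracket y z) + bracket y (bracket z x)
      + bracket z (bracket x y) = 0
}.

#[short(type="lieRingType")]
HB.structure Definition LieRing := { L of isLieRing L & GRing.Zmodule L }.

(** U(L) is the unital associative ring with generators iota x, x : L, subject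
    to additivity of iota and iota (bracket x y) = iota x * iota y - iota y * iota x.
    It is built as formal ring expressions in the generators modulo the least
    ring congruence [ueq] containing these relations; [uea_universal] is its
    universal property. *)
Inductive uterm (L : Type) : Type :=
| UGen of L
| UZero
| UOpp of uterm L
| UAdd of uterm L & uterm L
| UOne
| UMul of uterm L & uterm L.

Arguments UZero {L}.
Arguments UOne {L}.

HB.instance Definition _ (L : Type) := gen_eqMixin (uterm L).
HB.instance Definition _ (L : Type) := gen_choiceMixin (uterm L).

Inductive ueq (L : lieRingType) : uterm L -> uterm L -> Prop :=
| ueq_refl s : ueq s s
| ueq_sym s t : ueq s t -> ueq t s
| ueq_trans s t u : ueq s t -> ueq t u -> ueq s u
| ueq_opp s s' : ueq s s' -> ueq (UOpp s) (UOpp s')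
| ueq_add s s' t t' : ueq s s' -> ueq t t' -> ueq (UAdd s t) (UAdd s' t')
| ueq_mul s s' t t' : ueq s s' -> ueq t t' -> ueq (UMul s t) (UMul s' t')
| ueq_addA s t u : ueq (UAdd s (UAdd t u)) (UAdd (UAdd s t) u)
| ueq_addC s t : ueq (UAdd s t) (UAdd t s)
| ueq_add0 s : ueq (UAdd UZero s) s
| ueq_addN s : ueq (UAdd (UOpp s) s) UZero
| ueq_mulA s t u : ueq (UMul s (UMul t u)) (UMul (UMul s t) u)
| ueq_mul1l s : ueq (UMul UOne s) s
| ueq_mul1r s : ueq (UMul s UOne) s
| ueq_mulDl s t u : ueq (UMul (UAdd s t) u) (UAdd (UMul s u) (UMul t u))
| ueq_mulDr s t u : ueq (UMul s (UAdd t u)) (UAdd (UMul s t) (UMul s u))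
| ueq_genD x y : ueq (UGen (x + y)) (UAdd (UGen x) (UGen y))
| ueq_genL x y : ueq (UGen (bracket x y))
    (UAdd (UMul (UGen x) (UGen y)) (UOpp (UMul (UGen y) (UGen x)))).

Section UniversalEnveloping.
Variable L : lieRingType.

Definition ueqb (s t : uterm L) : bool := `[< ueq s t >].

Lemma ueqb_refl : reflexive ueqb.
Proof. by move=> s; apply/asboolP; exact: ueq_refl. Qed.

Lemma ueqb_sym : symmetric ueqb.
Proof. by move=> s t; apply/asboolP/asboolP; exact: ueq_sym. Qed.

Lemma ueqb_trans : transitive ueqb.
Proof.
by move=> s t u /asboolP ts /asboolP su; apply/asboolP; exact: ueq_trans ts su.
Qed.

Canonical ueqb_equiv := EquivRel ueqb ueqb_refl ueqb_sym ueqb_trans.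

Definition uea : Type := {eq_quot ueqb}%qT.
HB.instance Definition _ := Choice.copy uea {eq_quot ueqb}%qT.

Definition uclass (s : uterm L) : uea := (\pi_({eq_quot ueqb}) s)%qT.
Definition urepr (a : uea) : uterm L := repr (a : {eq_quot ueqb}%qT).

Lemma uclassP (s t : uterm L) : uclass s = uclass t <-> ueq s t.
Proof.
split=> [/eqmodP /asboolP //|st].
by apply/eqmodP/asboolP.
Qed.

Lemma uclass_repr (a : uea) : uclass (urepr a) = a.
Proof. exact: reprK. Qed.

Lemma uclassW (P : uea -> Prop) : (forall s, P (uclass s)) -> forall a, P a.
Proof. by move=> Ps a; rewrite -(uclass_repr a). Qed.

Lemma ueq_repr s : ueq (urepr (uclass s)) s.
Proof. by apply/uclassP; rewrite uclass_repr. Qed.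

Definition uzero : uea := uclass UZero.
Definition uone : uea := uclass UOne.
Definition uopp (a : uea) : uea := uclass (UOpp (urepr a)).
Definition uadd (a b : uea) : uea := uclass (UAdd (urepr a) (urepr b)).
Definition umul (a b : uea) : uea := uclass (UMul (urepr a) (urepr b)).

Lemma uoppE s : uopp (uclass s) = uclass (UOpp s).
Proof. by apply/uclassP/ueq_opp/ueq_repr. Qed.

Lemma uaddE s t : uadd (uclass s) (uclass t) = uclass (UAdd s t).
Proof. by apply/uclassP; apply: ueq_add; exact: ueq_repr. Qed.

Lemma umulE s t : umul (uclass s) (uclass t) = uclass (UMul s t).
Proof. by apply/uclassP; apply: ueq_mul; exact: ueq_repr. Qed.

Lemma uaddA : associative uadd.
Proof.
elim/uclassW=> s; elim/uclassW=> t; elim/uclassW=> u.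
by rewrite !uaddE; apply/uclassP; exact: ueq_addA.
Qed.

Lemma uaddC : commutative uadd.
Proof.
elim/uclassW=> s; elim/uclassW=> t.
by rewrite !uaddE; apply/uclassP; exact: ueq_addC.
Qed.

Lemma uadd0 : left_id uzero uadd.
Proof. by elim/uclassW=> s; rewrite uaddE; apply/uclassP; exact: ueq_add0. Qed.

Lemma uaddN : left_inverse uzero uopp uadd.
Proof.
by elim/uclassW=> s; rewrite uoppE uaddE; apply/uclassP; exact: ueq_addN.
Qed.

Lemma umulA : associative umul.
Proof.
elim/uclassW=> s; elim/uclassW=> t; elim/uclassW=> u.
by rewrite !umulE; apply/uclassP; exact: ueq_mulA.
Qed.

Lemma umul1l : left_id uone umul.
Proof. by elim/uclassW=> s; rewrite umulE; apply/uclassP; exact: ueq_mul1l. Qed.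

Lemma umul1r : right_id uone umul.
Proof. by elim/uclassW=> s; rewrite umulE; apply/uclassP; exact: ueq_mul1r. Qed.

Lemma umulDl : left_distributive umul uadd.
Proof.
elim/uclassW=> s; elim/uclassW=> t; elim/uclassW=> u.
by rewrite !(uaddE, umulE); apply/uclassP; exact: ueq_mulDl.
Qed.

Lemma umulDr : right_distributive umul uadd.
Proof.
elim/uclassW=> s; elim/uclassW=> t; elim/uclassW=> u.
by rewrite !(uaddE, umulE); apply/uclassP; exact: ueq_mulDr.
Qed.

Section Eval.
Variables (R : pzRingType) (f : L -> R).

Fixpoint ueval (s : uterm L) : R :=
  match s with
  | UGen x => f x
  | UZero => 0
  | UOpp s => - ueval s
  | UAdd s t => ueval s + ueval t
  | UOne => 1
  | UMul s t => ueval s * ueval t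
  end.

Hypothesis fD : {morph f : x y / x + y}.
Hypothesis fL : forall x y, f (bracket x y) = f x * f y - f y * f x.

Lemma ueval_ueq s t : ueq s t -> ueval s = ueval t.
Proof.
elim=> //= {s t}.
- by move=> s t u _ -> _ ->.
- by move=> s s' _ ->.
- by move=> s s' t t' _ -> _ ->.
- by move=> s s' t t' _ -> _ ->.
- by move=> s t u; rewrite addrA.
- by move=> s t; rewrite addrC.
- by move=> s; rewrite add0r.
- by move=> s; rewrite addNr.
- by move=> s t u; rewrite mulrA.
- by move=> s; rewrite mul1r.
- by move=> s; rewrite mulr1.
- by move=> s t u; rewrite mulrDl.
- by move=> s t u; rewrite mulrDr.
Qed.

Definition uea_lift (a : uea) : R := ueval (urepr a).

Lemma uea_liftE s : uea_lift (uclass s) = ueval s.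
Proof. by apply/ueval_ueq/ueq_repr. Qed.

End Eval.

Lemma uone_neq0 : uone != uzero.
Proof.
apply/negP=> /eqP /uclassP e.
have f0D : {morph (fun _ : L => 0 : int) : x y / x + y} by move=> x y; rewrite addr0.
have f0L (x y : L) : 0 = 0 * 0 - 0 * 0 :> int by rewrite subrr.
by have := ueval_ueq f0D f0L e.
Qed.

HB.instance Definition _ :=
  GRing.isZmodule.Build uea uaddA uaddC uadd0 uaddN.
HB.instance Definition _ :=
  GRing.Zmodule_isNzRing.Build uea umulA umul1l umul1r umulDl umulDr uone_neq0.

Definition uea_in (x : L) : uea := uclass (UGen x).

Lemma uea_inD : {morph uea_in : x y / x + y}.
Proof.
move=> x y; rewrite [RHS]uaddE.
by apply/uclassP; exact: ueq_genD.
Qed.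

Lemma uea_inL x y :
  uea_in (bracket x y) = uea_in x * uea_in y - uea_in y * uea_in x.
Proof.
have -> : uea_in x * uea_in y - uea_in y * uea_in x =
    uadd (umul (uea_in x) (uea_in y)) (uopp (umul (uea_in y) (uea_in x))) by [].
by rewrite !umulE uoppE uaddE; apply/uclassP; exact: ueq_genL.
Qed.

Lemma uea_universal (R : pzRingType) (f : L -> R) :
    {morph f : x y / x + y} ->
    (forall x y, f (bracket x y) = f x * f y - f y * f x) ->
  exists g : {rmorphism uea -> R},
    (forall x, g (uea_in x) = f x) /\
    forall h : {rmorphism uea -> R}, (forall x, h (uea_in x) = f x) -> h =1 g.
Proof.
move=> fD fL; pose g := uea_lift f.
have gE s : g (uclass s) = ueval f s by exact: uea_liftE.
have gB : zmod_morphism g.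
  elim/uclassW=> s; elim/uclassW=> t.
  have -> : uclass s - uclass t = uadd (uclass s) (uopp (uclass t)) by [].
  by rewrite uoppE uaddE !gE.
have gM : monoid_morphism g.
  split; first exact: gE.
  elim/uclassW=> s; elim/uclassW=> t.
  have -> : uclass s * uclass t = umul (uclass s) (uclass t) by [].
  by rewrite umulE !gE.
pose gZ := GRing.isZmodMorphism.Build _ _ g gB.
pose gR := GRing.isMonoidMorphism.Build _ _ g gM.
pose G : {rmorphism uea -> R} := HB.pack g gZ gR.
exists G; split=> [x|h hE]; first exact: gE.
elim/uclassW=> s; rewrite [RHS]gE.
elim: s => [x||s IHs|s IHs t IHt||s IHs t IHt] /=.
- exact: hE.
- exact: (rmorph0 h).
- by rewrite -IHs -rmorphN; congr (h _); rewrite -[LHS]uoppE.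
- by rewrite -IHs -IHt -rmorphD; congr (h _); rewrite -[LHS]uaddE.
- exact: (rmorph1 h).
- by rewrite -IHs -IHt -rmorphM; congr (h _); rewrite -[LHS]umulE.
Qed.

End UniversalEnveloping.

(** The additive subgroup generated by A. *)
Definition zspan (V : zmodType) (A : set V) : set V :=
  smallest (fun M : set V => zmod_closed (mem M)) A.

Definition two_sided_ideal (R : pzRingType) (I : set R) : Prop :=
  zmod_closed (mem I) /\ forall a x, x \in I -> a * x \in I /\ x * a \in I.

Definition ideal_gen (R : pzRingType) (A : set R) : set R :=
  smallest (@two_sided_ideal R) A.

Definition ideal_mul (R : pzRingType) (I J : set R) : set R :=
  zspan [set a * b | a in I & b in J].

(** [ideal_pow I 0] is the whole ring, and [ideal_pow I 1 = I] if I is an ideal. *)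
Definition ideal_pow (R : pzRingType) (I : set R) (n : nat) : set R :=
  iter n (ideal_mul I) setT.

(** gamma_n(L) for 1 <= n; the value at 0 is irrelevant. *)
Definition lcs (L : lieRingType) (n : nat) : set L :=
  iter n.-1 (fun A : set L => zspan [set bracket x y | x in setT & y in A]) setT.

Definition aug_ideal (L : lieRingType) : set (uea L) :=
  ideal_gen (range (@uea_in L)).

Definition lie_dim (L : lieRingType) (n : nat) : set L :=
  [set x | ideal_pow (@aug_ideal L) n (uea_in x)].

Arguments lcs : clear implicits.
Arguments aug_ideal : clear implicits.
Arguments lie_dim : clear implicits.

(* Main.v *)
Require Import Defs.
From HB Require Import structures.
From mathcomp Require Import all_boot all_algebra ring.
From mathcomp Require Import boolp classical_sets.

(** Let V = L / gamma_2(L), M = L / gamma_4(L) and let p : L -> M be the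
    projection. An additive map on U(L) that kills 1 and the fourth power of the
    augmentation ideal is the same thing as a family of multilinear maps F1, F2,
    F3 on words of length 1, 2, 3 in L, continued by zero to longer words, such
    that F(w, x, y, w') - F(w, y, x, w') = F(w, [x, y], w') whenever two adjacent
    letters are exchanged. Its value on iota(x) is F1(x).
    So it is enough to find such a family with values in M and F1(x) = p(2x):
    then p(2x) = 0 for every x in the fourth Lie dimension subring.

    The choice F1(x) = p(2x) and F2(x, y) = p[x, y] satisfies the relation in
    length 2, because the bracket is antisymmetric; this is where the factor 2
    is spent. With tau(x, y, z) = p[[x, y], z], a trilinear form on V, what is
    left is to find a trilinear form F3 on V with
      F3(x, y, z) - F3(y, x, z) = tau(x, y, z),
      F3(x, y, z) - F3(x, z, y) = - tau(y, z, x).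
    A combination of tau(x, y, z) and its permutations can satisfy three times
    these equations, and division by 3 is not possible in M. But if V is a direct sum of cyclic groups with basis b_i, a
    basis triple can be put in increasing order, as in the proof of the
    Poincare-Birkhoff-Witt theorem, and the Jacobi identity makes the result
    consistent without any division ([sorted_part], [normal_ordering]).

    An arbitrary V has no such basis, and since tensor powers do not preserve
    injections, an equality between tensors over V can fail over the subgroup
    generated by the letters that occur in it. The equality that puts
    iota(x) in the fourth power involves only finitely many letters X and
    finitely many of the relations among them, so the functional has to respect
    only those relations ([compatible], [lie_dim_vanishing]) and may be set to
    zero on all words with a letter outside X. The group with generators X and
    these finitely many relations is a direct sum of cyclic groups by the Smith
    normal form ([adapted_coordinates]), and F3 is built on it. *)

Set Implicit Arguments.
Unset Strict Implicit.
Unset Printing Implicit Defensive.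

Import GRing.Theory.
Local Open Scope classical_set_scope.
Local Open Scope ring_scope.

(** * Subgroups and quotients *)

Lemma zspan_closed (V : zmodType) (A : set V) : zmod_closed (mem (zspan A)).
Proof.
split=> [|x y]; rewrite !inE; first by move=> N [[N0 _] _]; rewrite -in_setE.
move=> Ax Ay N [NC AN]; rewrite -in_setE; apply: NC.2.
  by rewrite inE; exact: Ax.
by rewrite inE; exact: Ay.
Qed.

Lemma quotient_exists (V : zmodType) (N : set V) : zmod_closed (mem N) ->
  exists (M : zmodType) (p : {additive V -> M}), forall x, p x = 0 <-> N x.
Proof.
move=> NC.
pose S : zmodClosed V :=
  HB.pack (fun x => x \in N) (GRing.isZmodClosed.Build V (fun x => x \in N) NC).
pose p : {additive V -> Quotient.quot S} := \pi_(Quotient.quot S)%qT.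
exists (Quotient.quot S), p => x; rewrite /p.
have -> : N x <-> x \in N by rewrite inE.
rewrite -[x in x \in N]subr0 -[_ \in N]/(x - 0 \in S) Quotient.idealrBE raddf0.
by rewrite /=; split=> /eqP.
Qed.

(** * Functionals on words that kill a power of the augmentation ideal *)

Section Action.
Variables (L : lieRingType) (M : zmodType).
Implicit Types (m : seq L -> M) (s t : uterm L) (X : seq L).

(** If [m] reads a word as the value of an additive form on the product of its
    letters, then [act s m] comes in the same way from that form precomposed with
    right multiplication by [s]. *)
Fixpoint act s m : seq L -> M :=
  match s with
  | UGen x => fun w => m (rcons w x)
  | UZero => fun=> 0
  | UOpp s => fun w => - act s m w
  | UAdd s t => fun w => act s m w + act t m w
  | UOne => m
  | UMul s t => act s (act t m)
  end.

(** Only relations between letters of [X] are imposed, but inside arbitrary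
    words: the letters around the relation range over all of [L], which makes
    the condition stable under [act]. *)
Definition compatible X m : Prop :=
  (forall x y w w', x \in X -> y \in X -> x + y \in X ->
     m (w ++ x + y :: w') = m (w ++ x :: w') + m (w ++ y :: w')) /\
  (forall x y w w', x \in X -> y \in X -> bracket x y \in X ->
     m (w ++ bracket x y :: w')
       = m (w ++ [:: x, y & w']) - m (w ++ [:: y, x & w'])).

Lemma compatible_act X s m : compatible X m -> compatible X (act s m).
Proof.
elim: s m => [z||s IHs|s IHs t IHt||s IHs t IHt] m Cm //=.
- by split=> x y w w' *; rewrite !rcons_cat /= ?Cm.1 ?Cm.2.
- by split=> *; rewrite ?addr0 ?subr0.
- have C := IHs m Cm.
  by split=> * /=; [rewrite C.1 ?opprD | rewrite C.2 // opprB opprK addrC].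
- have [C C'] := (IHs m Cm, IHt m Cm).
  split=> * /=; [by rewrite C.1 // C'.1 // addrACA | rewrite C.2 // C'.2 //].
  by rewrite opprD addrACA.
- exact/IHs/IHt.
Qed.

Lemma act_add s m m' :
  act s (fun w => m w + m' w) = fun w => act s m w + act s m' w.
Proof.
elim: s m m' => [z||s IHs|s IHs t IHt||s IHs t IHt] m m' //=; apply/funext=> w.
- by rewrite addr0.
- by rewrite IHs opprD.
- by rewrite IHs IHt addrACA.
- by rewrite IHt IHs.
Qed.

(** Truth for all sufficiently large finite sets of letters. *)
Definition eventually (P : seq L -> Prop) : Prop :=
  exists X, forall X', {subset X <= X'} -> P X'.

Lemma eventually_and P Q :
  eventually P -> eventually Q -> eventually (fun X => P X /\ Q X).
Proof.
move=> [X PX] [Y QY]; exists (X ++ Y) => Z sXYZ; split.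
  by apply: PX => x xX; apply: sXYZ; rewrite mem_cat xX.
by apply: QY => x xX; apply: sXYZ; rewrite mem_cat xX orbT.
Qed.

Lemma eventually_imp P Q :
  (forall X, P X -> Q X) -> eventually P -> eventually Q.
Proof. by move=> PQ [X PX]; exists X => Y /PX /PQ. Qed.

Lemma eventually_mem x y z :
  eventually (fun X => [/\ x \in X, y \in X & z \in X]).
Proof.
by exists [:: x; y; z] => X sX; split; apply: sX; rewrite !inE eqxx ?orbT.
Qed.

(** A derivation of [ueq s t] uses the defining relations of U(L) finitely often,
    so a finite set of letters is enough to replay it on functionals. *)
Lemma eventually_act_eq s t : ueq s t ->
  eventually (fun X => forall m, compatible X m -> act s m = act t m).
Proof.
have triv P : (forall X, P X) -> eventually P by move=> PX; exists [::].
elim=> {s t}.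
- by move=> s; apply: triv.
- by move=> s t _; apply: eventually_imp => X st m /st.
- move=> s t u _ st _ tu; apply: eventually_imp (eventually_and st tu).
  by move=> X [{}st {}tu] m Cm; rewrite st ?tu.
- by move=> s s' _; apply: eventually_imp => X st m Cm /=; rewrite st.
- move=> s s' t t' _ ss' _ tt'; apply: eventually_imp (eventually_and ss' tt').
  by move=> X [{}ss' {}tt'] m Cm /=; rewrite ss' ?tt'.
- move=> s s' t t' _ ss' _ tt'; apply: eventually_imp (eventually_and ss' tt').
  by move=> X [{}ss' {}tt'] m Cm /=; rewrite tt' // ss' //; apply: compatible_act.
- by move=> s t u; apply: triv => X m _; apply/funext=> w /=; rewrite addrA.
- by move=> s t; apply: triv => X m _; apply/funext=> w /=; rewrite addrC.
- by move=> s; apply: triv => X m _; apply/funext=> w /=; rewrite add0r.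
- by move=> s; apply: triv => X m _; apply/funext=> w /=; rewrite addNr.
- by move=> s t u; apply: triv.
- by move=> s; apply: triv.
- by move=> s; apply: triv.
- by move=> s t u; apply: triv.
- by move=> s t u; apply: triv => X m _ /=; rewrite act_add.
- move=> x y; apply: eventually_imp (eventually_mem x y (x + y)).
  move=> X [xX yX xyX] m Cm; apply/funext=> w /=.
  by rewrite -!cats1 Cm.1.
- move=> x y; apply: eventually_imp (eventually_mem x y (bracket x y)).
  move=> X [xX yX xyX] m Cm; apply/funext=> w /=.
  by rewrite -!cats1 Cm.2 // -!catA.
Qed.

Definition vanishes_from k m : Prop := forall w, (k <= size w)%N -> m w = 0.

(** For a functional that vanishes on long words, elements of the k-th power of
    the augmentation ideal shorten by [k] the words on which it can be nonzero. *)
Definition lowers k s : Prop := eventually (fun X => forall m, compatible X m ->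
  forall j, vanishes_from (k + j)%N m -> vanishes_from j (act s m)).

Lemma lowers_eq k s t : ueq s t -> lowers k s -> lowers k t.
Proof.
move=> /eventually_act_eq st ls; apply: eventually_imp (eventually_and st ls).
by move=> X [{}st {}ls] m Cm j mj; rewrite -st //; apply: ls.
Qed.

Lemma vanishes_act s m j : vanishes_from j m -> vanishes_from j (act s m).
Proof.
elim: s m => [z||s IHs|s IHs t IHt||s IHs t IHt] m mj w jw //=.
- by apply: mj; rewrite size_rcons ltnW.
- by rewrite IHs ?oppr0.
- by rewrite IHs ?IHt ?addr0.
- exact: mj.
- by apply: IHs jw; apply: IHt.
Qed.

Lemma lowers0 s : lowers 0 s.
Proof. by exists [::] => X _ m _ j; apply: vanishes_act. Qed.

Lemma lowers_zero k : lowers k UZero.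
Proof. by exists [::]. Qed.

Lemma lowers_sub k s t : lowers k s -> lowers k t -> lowers k (UAdd s (UOpp t)).
Proof.
move=> ls lt; apply: eventually_imp (eventually_and ls lt).
move=> X [{}ls {}lt] m Cm j mj w jw /=.
by rewrite (ls m Cm j) // (lt m Cm j) // subrr.
Qed.

Lemma lowers_gen x : lowers 1 (UGen x).
Proof. by exists [::] => X _ m _ j mj w jw /=; apply: mj; rewrite size_rcons. Qed.

Lemma lowers_mul k l s t : lowers k s -> lowers l t -> lowers (k + l)%N (UMul s t).
Proof.
move=> ls lt; apply: eventually_imp (eventually_and ls lt).
move=> X [{}ls {}lt] m Cm j mj /=; apply: ls; first exact: compatible_act.
by apply: lt => //; rewrite addnA (addnC l).
Qed.

Definition lowering k : set (uea L) := [set u | lowers k (urepr u)].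

Lemma lowering_class k s : lowering k (uclass s) <-> lowers k s.
Proof.
by split; apply: lowers_eq; [|apply: ueq_sym]; apply: ueq_repr.
Qed.

Lemma lowering_closed k : zmod_closed (mem (lowering k)).
Proof.
split=> [|u v]; rewrite !inE; first exact/lowering_class/lowers_zero.
elim/uclassW: u => s; elim/uclassW: v => t /lowering_class ls /lowering_class lt.
have -> : uclass s - uclass t = uadd (uclass s) (uopp (uclass t)) by [].
by rewrite uoppE uaddE; apply/lowering_class/lowers_sub.
Qed.

Lemma lowering_mul k l u v :
  lowering k u -> lowering l v -> lowering (k + l)%N (u * v).
Proof.
elim/uclassW: u => s; elim/uclassW: v => t /lowering_class ls /lowering_class lt.
have -> : uclass s * uclass t = umul (uclass s) (uclass t) by [].
by rewrite umulE; apply/lowering_class/lowers_mul.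
Qed.

Lemma aug_ideal_lowering : aug_ideal L `<=` lowering 1.
Proof.
apply: smallest_sub => [|u [x _ <-]]; last exact/lowering_class/lowers_gen.
split=> [|u v]; first exact: lowering_closed.
have l0 : lowering 0 u by apply: lowers0.
rewrite !inE => lv.
by split; [exact: lowering_mul l0 lv | exact: lowering_mul lv l0].
Qed.

Lemma ideal_pow_lowering n : ideal_pow (aug_ideal L) n `<=` lowering n.
Proof.
elim: n => [u _|n IHn]; first exact: lowers0.
apply: smallest_sub => [|_ [u + [v + <-]]]; first exact: lowering_closed.
by move=> /aug_ideal_lowering lu /IHn lv; exact: lowering_mul lu lv.
Qed.

(** The value of a functional on the one-letter word [x] is the value at the
    empty word of its translate by iota(x), which is zero when iota(x) shortens
    words by [n]. *)
Lemma lie_dim_vanishing n x : lie_dim L n x ->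
  eventually (fun X => forall m, compatible X m -> vanishes_from n m ->
    m [:: x] = 0).
Proof.
move=> /ideal_pow_lowering /lowering_class; apply: eventually_imp => X lx m Cm mn.
have m0 : vanishes_from 0 (act (UGen x) m) by apply: lx; rewrite ?addn0.
exact: (m0 [::]).
Qed.

End Action.

(** * Finitely many relations in an abelian group *)

(** The Smith normal form read as a statement on the lattice spanned by the rows
    of [A]: in the basis of rows of [P], it is spanned by multiples of the basis
    vectors. *)
Lemma adapted_basis p n (A : 'M[int]_(p, n)) :
  exists (P : 'M[int]_n) (d : 'I_n -> int),
  [/\ P \in unitmx,
      forall i, exists c : 'rV[int]_p, d i *: row i P = c *m A
    & forall k i, (d i %| (row k A *m invmx P) 0%R i)%Z].
Proof.
have [Q Qu [P Pu [s _ AE]]] := int_Smith_normal_form A.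
set D := \matrix_(i, j) _ in AE.
have DE k (i : 'I_n) : D k i = s`_i *+ (k == i :> nat).
  by rewrite mxE; case: eqP => // ->.
(* A basis vector beyond the number of relations is free: its order is 0. *)
exists P, (fun i : 'I_n => if (i < p)%N then s`_i else 0); split=> // [i|k i].
  case: ltnP => [ip|_]; last by exists 0; rewrite mul0mx scale0r.
  exists (row (Ordinal ip) (invmx Q)).
  rewrite -row_mul AE mulmxA mulmxA mulVmx // mul1mx row_mul.
  apply/rowP=> j; rewrite !mxE (bigD1 i) //= mxE DE eqxx mulr1n.
  rewrite big1 ?addr0 // => l li.
  by rewrite mxE DE eq_sym val_eqE (negbTE li) mul0r.
rewrite -row_mul AE mulmxK // mxE mxE.
case: ltnP => [ip|pi].
  rewrite (bigD1 (Ordinal ip)) //= DE eqxx mulr1n.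
  rewrite big1 ?addr0 ?dvdz_mull // => l li.
  suff /negbTE ne : (l != i :> nat) by rewrite DE ne mulr0.
  by apply: contra li => /eqP e; apply/eqP/val_inj.
rewrite big1 ?dvd0z // => l _; rewrite DE.
suff /negbTE -> : (l != i :> nat) by rewrite mulr0.
by rewrite neq_ltn (leq_trans _ pi).
Qed.

(** The group [V / N], seen through a finite set [X] and the finitely many
    relations inside [X], looks like the direct sum of the cyclic groups of
    orders [d i], with basis [b] and coordinates [kappa]. These coordinates are
    additive only where the relation lives in [X], and no such basis of the whole
    of [V / N] need exist. *)
Lemma adapted_coordinates (V : zmodType) (N : set V) (X : seq V) :
  zmod_closed (mem N) ->
  exists n (b : 'I_n -> V) (d : 'I_n -> int) (kappa : V -> 'I_n -> int),
  [/\ forall i, N (b i *~ d i),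
      forall x, x \in X -> x = \sum_i b i *~ kappa x i,
      forall x y i, x \in X -> y \in X -> x + y \in X ->
        (d i %| kappa (x + y)%R i - (kappa x i + kappa y i))%Z
    & forall x i, x \in X -> N x -> (d i %| kappa x i)%Z].
Proof.
move=> NC; set n := size X.
pose S : zmodClosed V :=
  HB.pack (fun x => x \in N) (GRing.isZmodClosed.Build V (fun x => x \in N) NC).
have SP x : x \in S <-> N x by rewrite -[x \in S]/(x \in N) inE.
pose ev (u : 'rV[int]_n) : V := \sum_(j < n) X`_j *~ u 0 j.
pose e x : 'rV[int]_n := \row_j (j == index x X :> nat)%:R.
have evB u v : ev (u - v) = ev u - ev v.
  by rewrite /ev -sumrB; apply: eq_bigr => j _; rewrite !mxE mulrzBr.
pose evA : {additive 'rV[int]_n -> V} :=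
  HB.pack ev (GRing.isZmodMorphism.Build _ _ ev evB).
have evD u v : ev (u + v) = ev u + ev v by exact: (raddfD evA).
have ev_sum I (r : seq I) F : ev (\sum_(i <- r) F i) = \sum_(i <- r) ev (F i).
  exact: (raddf_sum evA).
have evZ c u : ev (c *: u) = ev u *~ c.
  by rewrite -[c in LHS]intz scaler_int; exact: (raddfMz evA).
have ev_e x : x \in X -> ev (e x) = x.
  move=> xX; have lt : (index x X < n)%N by rewrite index_mem.
  rewrite /ev (bigD1 (Ordinal lt)) //= mxE eqxx nth_index //.
  rewrite big1 ?addr0 // => j ne.
  suff /negbTE ne' : (j != index x X :> nat) by rewrite mxE ne'.
  by apply: contra ne => /eqP E; apply/eqP/val_inj.
pose rels :=
  [seq e (z.1 + z.2)%R - (e z.1 + e z.2)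
    | z <- [seq (x, y) | x <- X, y <- X] & z.1 + z.2 \in X]
  ++ [seq e x | x <- X & x \in N].
have relsN r : r \in rels -> ev r \in S.
  rewrite mem_cat => /orP[] /mapP[z]; rewrite mem_filter => /andP[].
    move=> zX /allpairsP[[x y] /= [xX yX zE]] ->; move: zX.
    rewrite zE [_.1]/= [_.2]/= => zX.
    by rewrite evB evD !ev_e // subrr; exact: (rpred0 S).
  by move=> zN zX ->; rewrite ev_e.
pose A : 'M[int]_(size rels, n) := \matrix_(k < size rels) rels`_k.
have [P [d [Pu dP dA]]] := adapted_basis A.
have dvd_rel r i : r \in rels -> (d i %| (r *m invmx P) 0%R i)%Z.
  move=> rr; have lt : (index r rels < size rels)%N by rewrite index_mem.
  by have := dA (Ordinal lt) i; rewrite rowK /= nth_index.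
exists n, (fun i => ev (row i P)), d, (fun x i => (e x *m invmx P) 0 i).
split=> [i|x xX|x y i xX yX xyX|x i xX Nx].
- apply/SP; rewrite -evZ; have [c ->] := dP i.
  rewrite mulmx_sum_row ev_sum.
  apply: rpred_sum => k _; rewrite evZ rpredMz // rowK relsN // mem_nth //.
- rewrite -[LHS]ev_e // -[e x in LHS](mulmxKV Pu) mulmx_sum_row.
  rewrite ev_sum; apply: eq_bigr => i _.
  by rewrite evZ.
- have /dvd_rel-/(_ i) : e (x + y)%R - (e x + e y) \in rels.
    rewrite mem_cat; apply/orP; left; apply/mapP; exists (x, y) => //.
    by rewrite mem_filter /= xyX; apply/allpairsP; exists (x, y).
  by rewrite mulmxBl mulmxDl !mxE.
- apply: dvd_rel; rewrite mem_cat; apply/orP; right; apply/mapP; exists x => //.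
  by rewrite mem_filter xX andbT inE.
Qed.

(** * Normal ordering of cubic monomials *)

Lemma additive_comb (V M : zmodType) (f : V -> M) n (b : 'I_n -> V)
    (k : 'I_n -> int) : {morph f : x y / x + y} ->
  f (\sum_i b i *~ k i) = \sum_i f (b i) *~ k i.
Proof.
move=> fD; have f0 : f 0 = 0.
  by apply: (addrI (f 0)); rewrite -fD !addr0.
have fB x y : f (x - y) = f x - f y by apply: (addIr (f y)); rewrite -fD !subrK.
pose F : {additive V -> M} := HB.pack f (GRing.isZmodMorphism.Build _ _ f fB).
rewrite -[f]/(F : _ -> _) raddf_sum; apply: eq_bigr => i _; exact: raddfMz.
Qed.

Lemma mulrz_dvd (M : zmodType) (a : M) d k :
  a *~ d = 0 -> (d %| k)%Z -> a *~ k = 0.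
Proof. by move=> ad /dvdzP[q ->]; rewrite mulrC mulrzA ad mul0rz. Qed.

Section OrderedSplitting.
Variables (M : zmodType) (n : nat) (Phi : 'I_n -> 'I_n -> 'I_n -> M).
Hypothesis PhiC : forall i j k, Phi j i k = - Phi i j k.
Hypothesis Phixx : forall i k, Phi i i k = 0.
Hypothesis PhiJ : forall i j k, Phi i j k + Phi j k i + Phi k i j = 0.

(** Think of [Phi i j k] as [b_i, b_j] bracketed with [b_k], for basis elements
    [b_0, b_1, ...]. To [i] and the unordered pair of [j] and [k] this attaches
    the one basic bracket, with its smallest index in the middle, or 0 if [i] is
    smallest. That splits the dual Koszul differential: the form is symmetric in
    the last two indices and its antisymmetrization in the first two is [Phi]. As
    its values are values of [Phi], whatever annihilates [Phi] annihilates it;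
    the symmetric formula (Phi i j k + Phi i k j) / 3 would need a division. *)
Definition sorted_part (i j k : 'I_n) : M :=
  if (j <= k)%N then if (j < i)%N then Phi i j k else 0
  else if (k < i)%N then Phi i k j else 0.

Lemma sorted_partC i j k : sorted_part i j k = sorted_part i k j.
Proof.
rewrite /sorted_part; case: (ltngtP j k) => // e.
by rewrite (val_inj e).
Qed.

Lemma sorted_part_swap i j k : sorted_part i j k - sorted_part j i k = Phi i j k.
Proof.
wlog le_ij : i j / (i <= j)%N.
  move=> H; case: (leqP i j) => [/H //|/ltnW/H e].
  by rewrite PhiC -e opprB.
(* If [k] is the least index, both terms are sorted to [k] in the middle and the
   Jacobi identity joins them; otherwise [i] is least and one term vanishes. *)
have [lt_ki|le_ik] := ltnP k i.
  rewrite /sorted_part (leqNgt j k) (leqNgt i k) (leq_trans lt_ki le_ij) lt_ki /=.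
  rewrite PhiC (_ : Phi k i j = - (Phi i j k + Phi j k i)) ?opprK ?addrK //.
  by apply/eqP; rewrite -addr_eq0 addrC PhiJ.
have G0 : sorted_part i j k = 0.
  rewrite /sorted_part (ltnNge j i) (ltnNge k i) le_ij le_ik.
  by case: ifP.
rewrite G0 sub0r /sorted_part le_ik; case: (ltnP i j) => [_|le_ji].
  by rewrite PhiC opprK.
have /val_inj -> : i = j :> nat by apply/eqP; rewrite eqn_leq le_ij.
by rewrite Phixx oppr0.
Qed.

(** Correcting [Phi] by a form that is symmetric in the last two indices leaves
    the exchange of those two as it is for [Phi], where the Jacobi identity turns
    it into a single bracket, and halves the exchange of the first two. *)
Definition normal_part (i j k : 'I_n) : M := Phi i j k - sorted_part i j k.

Lemma normal_part_swap12 i j k :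
  normal_part i j k - normal_part j i k = Phi i j k.
Proof.
have /eqP := sorted_part_swap i j k; rewrite subr_eq => /eqP G.
by rewrite /normal_part G (PhiC i) -opprD opprK subrK.
Qed.

Lemma normal_part_swap23 i j k :
  normal_part i j k - normal_part i k j = - Phi j k i.
Proof.
rewrite /normal_part (sorted_partC i k) opprB addrA subrK.
by apply/eqP; rewrite -addr_eq0 (PhiC k) opprK addrAC PhiJ.
Qed.

Variable d : 'I_n -> int.
Hypothesis Phi_d : forall i j k,
  [/\ Phi i j k *~ d i = 0, Phi i j k *~ d j = 0 & Phi i j k *~ d k = 0].

Lemma normal_part_torsion i j k :
  [/\ normal_part i j k *~ d i = 0, normal_part i j k *~ d j = 0
    & normal_part i j k *~ d k = 0].
Proof.
have [p1 p2 p3] := Phi_d i j k; have [q1 q2 q3] := Phi_d i k j.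
rewrite /normal_part /sorted_part.
by case: (leqP j k) => _; case: ltnP => _;
  split; rewrite mulrzBl ?(p1, p2, p3, q1, q2, q3) ?mul0rz subrr.
Qed.

End OrderedSplitting.

Section CubicForm.
Variables (n : nat) (M : zmodType).
Implicit Types (c : 'I_n -> 'I_n -> 'I_n -> M) (d u v w : 'I_n -> int).

Definition cubic c u v w : M :=
  \sum_(p : 'I_n * 'I_n * 'I_n)
    c p.1.1 p.1.2 p.2 *~ (u p.1.1 * v p.1.2 * w p.2).

Lemma cubic_perm12 c u v w : cubic c u v w = cubic (fun i j k => c j i k) v u w.
Proof.
rewrite /cubic (reindex_inj (h := fun p => (p.1.2, p.1.1, p.2))) /=.
  by apply: eq_bigr => p _; rewrite [u _ * _]mulrC.
by move=> [[i j] k] [[i' j'] k'] [-> -> ->].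
Qed.

Lemma cubic_perm23 c u v w : cubic c u v w = cubic (fun i j k => c i k j) u w v.
Proof.
rewrite /cubic (reindex_inj (h := fun p => (p.1.1, p.2, p.1.2))) /=.
  by apply: eq_bigr => p _; rewrite mulrAC.
by move=> [[i j] k] [[i' j'] k'] [-> -> ->].
Qed.

Lemma cubic_swap12 c c' u v w : (forall i j k, c i j k - c j i k = c' i j k) ->
  cubic c u v w - cubic c v u w = cubic c' u v w.
Proof.
move=> cc'; rewrite [cubic c v u w]cubic_perm12 /cubic -sumrB.
by apply: eq_bigr => p _; rewrite -mulrzBl cc'.
Qed.

Lemma cubic_swap23 c c' u v w : (forall i j k, c i j k - c i k j = c' i j k) ->
  cubic c u v w - cubic c u w v = cubic c' u v w.
Proof.
move=> cc'; rewrite [cubic c u w v]cubic_perm23 /cubic -sumrB.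
by apply: eq_bigr => p _; rewrite -mulrzBl cc'.
Qed.

(** Coordinates matter only modulo the orders [d] of the basis elements. *)
Lemma cubic_add1 c d u u' u'' v w : (forall i j k, c i j k *~ d i = 0) ->
    (forall i, (d i %| u i - (u' i + u'' i))%Z) ->
  cubic c u v w = cubic c u' v w + cubic c u'' v w.
Proof.
move=> cd du; rewrite /cubic -big_split /=; apply: eq_bigr => -[[i j] k] _ /=.
rewrite -mulrzDr -2!mulrDl; apply/eqP; rewrite -subr_eq0 -mulrzBr -2!mulrBl.
by rewrite (mulrz_dvd (cd i j k)) // -mulrA dvdz_mulr.
Qed.

Lemma cubic_add2 c d u v v' v'' w : (forall i j k, c i j k *~ d j = 0) ->
    (forall i, (d i %| v i - (v' i + v'' i))%Z) ->
  cubic c u v w = cubic c u v' w + cubic c u v'' w.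
Proof.
by move=> cd dv; rewrite ![cubic c u _ _]cubic_perm12; apply: cubic_add1 dv => *.
Qed.

Lemma cubic_add3 c d u v w w' w'' : (forall i j k, c i j k *~ d k = 0) ->
    (forall i, (d i %| w i - (w' i + w'' i))%Z) ->
  cubic c u v w = cubic c u v w' + cubic c u v w''.
Proof.
by move=> cd dw; rewrite ![cubic c u v _]cubic_perm23; apply: cubic_add2 dw => *.
Qed.

End CubicForm.

(** * A cubic form with prescribed exchange rules *)

Section NormalOrdering.
Variables (V M : zmodType) (N : set V) (tau : V -> V -> V -> M).
Hypothesis NC : zmod_closed (mem N).
Hypothesis tauD1 : forall x x' y z, tau (x + x') y z = tau x y z + tau x' y z.
Hypothesis tauD2 : forall x y y' z, tau x (y + y') z = tau x y z + tau x y' z.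
Hypothesis tauD3 : forall x y z z', tau x y (z + z') = tau x y z + tau x y z'.
Hypothesis tauxx : forall x z, tau x x z = 0.
Hypothesis tauJ : forall x y z, tau x y z + tau y z x + tau z x y = 0.
Hypothesis tauN1 : forall x y z, N x -> tau x y z = 0.
Hypothesis tauN3 : forall x y z, N z -> tau x y z = 0.

Lemma tau_comb n (b : 'I_n -> V) u v w :
  tau (\sum_i b i *~ u i) (\sum_i b i *~ v i) (\sum_i b i *~ w i)
  = cubic (fun i j k => tau (b i) (b j) (b k)) u v w.
Proof.
pose F i j k := tau (b i) (b j) (b k) *~ (u i * v j * w k).
rewrite /cubic -(pair_bigA _ (fun p k => F p.1 p.2 k)) /=.
rewrite -(pair_bigA _ (fun i j => \sum_k F i j k)) /=.
rewrite (@additive_comb _ _ (fun x => tau x _ _)) //; apply: eq_bigr => i _.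
rewrite (@additive_comb _ _ (fun y => tau _ y _)) // mulrz_suml.
apply: eq_bigr => j _.
rewrite (@additive_comb _ _ (fun z => tau _ _ z)) // 2!mulrz_suml.
by apply: eq_bigr => k _; rewrite /F -!mulrzA; congr (_ *~ _); ring.
Qed.

Lemma tauC x y z : tau y x z = - tau x y z.
Proof.
have := tauxx (x + y) z; rewrite tauD1 !tauD2 !tauxx add0r addr0 => /eqP.
by rewrite addrC addr_eq0 => /eqP.
Qed.

Definition trilinear_among (X : seq V) (F : V -> V -> V -> M) : Prop :=
  (forall x y z t, x \in X -> y \in X -> x + y \in X -> z \in X -> t \in X ->
    [/\ F (x + y) z t = F x z t + F y z t,
        F z (x + y) t = F z x t + F z y t
      & F z t (x + y) = F z t x + F z t y]) /\
  (forall x z t, x \in X -> N x ->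
    [/\ F x z t = 0, F z x t = 0 & F z t x = 0]).

(** Dual to the exactness of the Koszul complex of [V / N], but for the letters
    of [X] only: a form on brackets that satisfies the Jacobi identity extends to
    words of length 3. Coordinates reduce it to [normal_part] on basis triples. *)
Lemma normal_ordering X : exists F : V -> V -> V -> M,
  [/\ trilinear_among X F,
      forall x y z, x \in X -> y \in X -> z \in X ->
        F x y z - F y x z = tau x y z
    & forall x y z, x \in X -> y \in X -> z \in X ->
        F x y z - F x z y = - tau y z x].
Proof.
have [n [b [d [kappa [bd Xb kD kN]]]]] := adapted_coordinates X NC.
pose Phi i j k := tau (b i) (b j) (b k).
have PhiC i j k : Phi j i k = - Phi i j k by exact: tauC.
have PhiJ i j k : Phi i j k + Phi j k i + Phi k i j = 0 by exact: tauJ.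
have Phi_d i j k : [/\ Phi i j k *~ d i = 0, Phi i j k *~ d j = 0
    & Phi i j k *~ d k = 0].
  have tauMz1 x y z m : tau (x *~ m) y z = tau x y z *~ m.
    have := @additive_comb _ _ (fun x => tau x y z) 1 (fun=> x) (fun=> m).
    by rewrite !big_ord1; apply.
  have tauMz3 x y z m : tau x y (z *~ m) = tau x y z *~ m.
    have := @additive_comb _ _ (fun z => tau x y z) 1 (fun=> z) (fun=> m).
    by rewrite !big_ord1; apply.
  split; last by rewrite -tauMz3 tauN3.
    by rewrite -tauMz1 tauN1.
  by rewrite PhiC mulNrz -tauMz1 tauN1 ?oppr0.
pose c := normal_part Phi.
have c1 i j k : c i j k *~ d i = 0 by have [] := normal_part_torsion Phi_d i j k.
have c2 i j k : c i j k *~ d j = 0 by have [] := normal_part_torsion Phi_d i j k.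
have c3 i j k : c i j k *~ d k = 0 by have [] := normal_part_torsion Phi_d i j k.
exists (fun x y z => cubic c (kappa x) (kappa y) (kappa z)); split.
- split=> [x y z t xX yX xyX zX tX|x z t xX Nx].
    have dk i := kD x y i xX yX xyX.
    by split; [apply: cubic_add1 dk | apply: cubic_add2 dk | apply: cubic_add3 dk].
  (* If the coordinates of [x] are zero modulo [d] then they are twice
     themselves, so the value [v] of the form at [x] satisfies [v = v + v]. *)
  have dk i : (d i %| kappa x i - (kappa x i + kappa x i))%Z.
    by rewrite opprD addNKr rpredN kN.
  split; apply: (@addrI _ (cubic _ _ _ _)); rewrite addr0; symmetry.
  - exact: cubic_add1 dk.
  - exact: cubic_add2 dk.
  - exact: cubic_add3 dk.
- move=> x y z xX yX zX; rewrite (cubic_swap12 (c' := Phi)).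
    by rewrite -tau_comb -!Xb.
  by move=> i j k; apply: normal_part_swap12 => // *; apply: tauxx.
- move=> x y z xX yX zX; rewrite (cubic_swap23 (c' := fun i j k => - Phi j k i)).
    rewrite [in RHS](Xb x) // [in RHS](Xb y) // [in RHS](Xb z) // tau_comb.
    rewrite [cubic _ (kappa y) _ _]cubic_perm23.
    rewrite [cubic _ (kappa y) _ _]cubic_perm12 /cubic -sumrN.
    by apply: eq_bigr => p _; rewrite mulNrz.
  by move=> i j k; apply: normal_part_swap23.
Qed.

End NormalOrdering.

(** * Brackets in the lower central series *)

Section LieRing.
Variable L : lieRingType.
Implicit Types x y z : L.

Lemma bracketC x y : bracket y x = - bracket x y.
Proof.
have := bracketxx (x + y).
rewrite bracketDl !bracketDr !bracketxx add0r addr0 => /eqP.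
by rewrite addrC addr_eq0 => /eqP.
Qed.

Lemma bracket0r x : bracket x 0 = 0.
Proof. by apply: (addrI (bracket x 0)); rewrite -bracketDr !addr0. Qed.

Lemma bracket0l x : bracket 0 x = 0.
Proof. by rewrite bracketC bracket0r oppr0. Qed.

Lemma bracketNr x y : bracket x (- y) = - bracket x y.
Proof. by apply/eqP; rewrite -addr_eq0 -bracketDr addNr bracket0r. Qed.

Lemma lcs_closed n : zmod_closed (mem (lcs L n)).
Proof.
have TC : zmod_closed (mem (setT : set L)) by split=> [|? ? _ _]; rewrite in_setT.
by case: n => [|[|n]]; [exact: TC|exact: TC|exact: zspan_closed].
Qed.

Lemma lcs_bracket n x y : lcs L n.+1 y -> lcs L n.+2 (bracket x y).
Proof. by move=> Ly; apply: sub_gen_smallest; exists x => //; exists y. Qed.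

Lemma lcsN n x : lcs L n x -> lcs L n (- x).
Proof.
have [L0 LB] := lcs_closed n.
by move=> Lx; have := LB _ _ L0 (mem_set Lx); rewrite sub0r inE.
Qed.

Lemma lcs_bracketr n x y : lcs L n.+1 y -> lcs L n.+2 (bracket y x).
Proof. by move=> Ly; rewrite bracketC; apply: lcsN; apply: lcs_bracket Ly. Qed.

Lemma lcs2_ind (P : set L) : zmod_closed (mem P) ->
  (forall x y, P (bracket x y)) -> lcs L 2 `<=` P.
Proof. by move=> PC Pb; apply: smallest_sub => // _ [x _ [y _ <-]]; apply: Pb. Qed.

Lemma lcs4_triple1 x y z : lcs L 2 x -> lcs L 4 (bracket (bracket x y) z).
Proof. by move=> Lx; apply: lcs_bracketr; apply: lcs_bracketr. Qed.

(** If [z] is the bracket of [a] and [b], the Jacobi identity brackets [x, y],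
    which has weight 2, with [a] and [b] one after the other. *)
Lemma lcs4_triple3 x y z : lcs L 2 z -> lcs L 4 (bracket (bracket x y) z).
Proof.
have [L0 LB] := lcs_closed 4; move: z; apply: lcs2_ind => [|a b].
  split=> [|u v]; rewrite !inE /=.
    by have := L0; rewrite bracket0r inE.
  rewrite bracketDr bracketNr => /mem_set Lu /mem_set Lv.
  by have := LB _ _ Lu Lv; rewrite inE.
have c2 : lcs L 2 (bracket x y) by apply: lcs_bracket.
have /eqP := bracket_jacobi (bracket x y) a b.
rewrite -addrA addr_eq0 => /eqP ->; apply: lcsN.
have LD u v : lcs L 4 u -> lcs L 4 v -> lcs L 4 (u + v).
  by move=> Lu /lcsN/mem_set Lv; have := LB _ _ (mem_set Lu) Lv; rewrite opprK inE.
by apply: LD; apply: lcs_bracket; [apply: lcs_bracket|apply: lcs_bracketr].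
Qed.

End LieRing.

(** * The fourth Lie dimension subring *)

Theorem corollary4p10 (L : lieRingType) :
  [set x *+ 2 | x in lie_dim L 4] `<=` lcs L 4.
Proof.
move=> _ [x dx <-].
have [M [p pE]] := quotient_exists (lcs_closed L 4).
apply/pE.
have [X0 vX] := lie_dim_vanishing M dx.
(* [x] must be a letter, for the functional to see it. *)
pose X := x :: X0.
pose tau x y z := p (bracket (bracket x y) z).
have tauD1 a a' b c : tau (a + a') b c = tau a b c + tau a' b c.
  by rewrite /tau !bracketDl raddfD.
have tauD2 a b b' c : tau a (b + b') c = tau a b c + tau a b' c.
  by rewrite /tau bracketDr bracketDl raddfD.
have tauD3 a b c c' : tau a b (c + c') = tau a b c + tau a b c'.
  by rewrite /tau bracketDr raddfD.
have tauxx a c : tau a a c = 0.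
  by rewrite /tau bracketxx bracket0l raddf0.
have tauJ a b c : tau a b c + tau b c a + tau c a b = 0.
  rewrite /tau -!raddfD (bracketC c (bracket a b)) (bracketC a (bracket b c)).
  rewrite (bracketC b (bracket c a)) -!opprD -addrA addrC bracket_jacobi.
  by rewrite oppr0 raddf0.
have tauN1 a b c : lcs L 2 a -> tau a b c = 0.
  by move=> Na; apply/pE; apply: lcs4_triple1 Na.
have tauN3 a b c : lcs L 2 c -> tau a b c = 0.
  by move=> Nc; apply/pE; apply: lcs4_triple3 Nc.
have [F [[FD F0] F12 F23]] :=
  normal_ordering (lcs_closed L 2) tauD1 tauD2 tauD3 tauxx tauJ tauN1 tauN3 X.
(* The components F1, F2, F3 of the functional, before restriction to words
   with all letters in [X]. *)
pose m0 w : M := match w with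
  | [:: a] => p (a *+ 2)
  | [:: a; b] => p (bracket a b)
  | [:: a; b; c] => F a b c
  | _ => 0
  end.
pose m w := if all (mem X) w then m0 w else 0.
have <- : m [:: x] = p (x *+ 2) by rewrite /m /= inE eqxx.
have m0_long w : (3 < size w)%N -> m0 w = 0.
  by case: w => [|a [|b [|c [|e w]]]].
apply: (vX X) => [a aX||w lw]; first by rewrite /X inE aX orbT.
  split=> a b w w' aX bX abX; rewrite /m !all_cat /= !inE.
    rewrite [(a == x) || _]aX [(b == x) || _]bX [(a + b == x) || _]abX /=.
    case: ifP => [|_]; last by rewrite addr0.
    case: (leqP 3 (size w + size w')) => [lww' _|].
      by rewrite !m0_long ?addr0 // size_cat addnS.
    case: w => [|c [|e [|f w]]]; case: w' => [|g [|h [|k w']]] //= _;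
      rewrite ?andbT.
    - by rewrite mulrnDl raddfD.
    - by rewrite bracketDl raddfD.
    - by case/andP=> gX hX; have [] := FD a b g h aX bX abX gX hX.
    - by rewrite bracketDr raddfD.
    - by case/andP=> cX gX; have [] := FD a b c g aX bX abX cX gX.
    - by case/andP=> cX eX; have [] := FD a b c e aX bX abX cX eX.
  have Nab : lcs L 2 (bracket a b) by apply: lcs_bracket.
  rewrite [(a == x) || _]aX [(b == x) || _]bX [(_ == x) || _]abX /=.
  case: ifP => [|_]; last by rewrite subr0.
  case: (leqP 3 (size w + size w')) => [lww' _|].
    by rewrite !m0_long ?subr0 // size_cat !addnS // ltnS ltnW.
  case: w => [|c [|e [|f w]]]; case: w' => [|g [|h [|k w']]] //= _;
    rewrite ?andbT ?subr0.
  - by rewrite -raddfB (bracketC a b) opprK mulr2n.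
  - by move=> gX; rewrite F12.
  - by case/andP=> gX hX; have [] := F0 _ g h abX Nab.
  - by move=> cX; rewrite F23 // /tau bracketC raddfN.
  - by case/andP=> cX gX; have [] := F0 _ c g abX Nab.
  - by case/andP=> cX eX; have [] := F0 _ c e abX Nab.
by rewrite /m m0_long // if_same.
Qed.
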